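(* Let $n,a,x,y$ be integers such that $x$ is even, $x\neq y$, $1\leq x,y\leq n$ and $1\leq a<n$. Let $d=\gcd(x,2n)$ and suppose that $\gcd(d,y)=1$. There exists a perfect matching $F$ of $K_{2n}$ such that $\ell(F)=\{x^{n-a},y^a\}$ if and only if one of the following cases occurs: (1) $d$ divides $n$ and $n-a$ is even; (2) $d$ does not divide $n$ and $n-a$ is an even integer such that $n-a\leq \frac{2n-d}{2}$.
   Context: For a positive integer $v$, $K_v$ denotes the complete graph on the vertex set $\{0,1,\ldots,v-1\}$. The length of an edge $\{u,w\}$ of $K_v$ is $\ell(u,w)=\min(|u-w|,\,v-|u-w|)$. For a subgraph $\Gamma$ of $K_v$, $\ell(\Gamma)$ is the list (multiset) of lengths of all edges of $\Gamma$, counted with multiplicity. A perfect matching of $K_{2n}$ is a set of $n$ pairwise disjoint edges covering all vertices. The notation $\{x^{b},y^{c}\}$ denotes the list containing $b$ copies of $x$ and $c$ copies of $y$. *)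

(* Defs.v *)
From mathcomp Require Import all_boot all_order all_algebra.

Set Implicit Arguments.
Unset Strict Implicit.
Unset Printing Implicit Defensive.

Definition complete_graph (v : nat) : {set {set 'I_v}} := 
  [set e : {set 'I_v} | #|e| == 2].

Definition vertex_length (v : nat) (u w : 'I_v) : nat :=
  minn `|u - w| (v - `|u - w|).

(* [enum e] lists the two endpoints of an edge [e]; sets that are not edges get
   the junk value 0. *)
Definition edge_length (v : nat) (e : {set 'I_v}) : nat :=
  if enum e is [:: u; w] then vertex_length u w else 0.

(* One entry per edge of [G]; the order is irrelevant, so such lists are to be
   compared up to [perm_eq]. *)
Definition length_list (v : nat) (G : {set {set 'I_v}}) : seq nat :=
  [seq edge_length e | e <- enum G].

Definition perfect_matching (n : nat) (F : {set {set 'I_(2 * n)}}) : Prop :=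
  [/\ F \subset complete_graph (2 * n), #|F| = n, trivIset F
    & cover F = [set: 'I_(2 * n)]].

(* Main.v *)
(** Since [x] is even and [y] is odd, the sum of all vertices has the parity of [n]
    and also that of the sum of the lengths, which is that of [a].  The edges of
    length [x] stay inside the classes mod [d], each of size [m = 2n/d]; if [m] is
    odd, every class contains an endpoint of an edge of length [y], so [d <= 2a].
    Conversely [y] generates the integers mod [d], hence every vertex is uniquely
    [i * y + j * x] with [i < d] and [j < m].  On this grid take all vertical edges
    between rows [2p] and [2p + 1], and turn the two vertical edges of [(n - a)/2]
    disjoint [2 x 2] blocks into horizontal ones. *)

Require Import Defs.
From mathcomp Require Import all_boot all_order all_algebra.
From mathcomp Require Import zify.

(** * Edge lengths *)

Lemma vertex_lengthC {v} (u w : 'I_v) : vertex_length u w = vertex_length w u.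
Proof. by rewrite /vertex_length distnC. Qed.

Lemma vertex_length_le {v} (u w : 'I_v) :
  u <= w -> vertex_length u w = minn (w - u) (v - (w - u)).
Proof. by move=> le_uw; rewrite /vertex_length distnEr. Qed.

Lemma edge_length2 {v} (u w : 'I_v) :
  u != w -> edge_length [set u; w] = vertex_length u w.
Proof.
move=> neq_uw; rewrite /edge_length.
have := enum_uniq [set u; w]; have := cardE [set u; w].
(* The order of [enum] is unspecified: size 2, uniqueness and inclusion leave two lists,
   interchangeable by symmetry of the length. *)
have: {subset enum [set u; w] <= [:: u; w]}.
  by move=> z; rewrite mem_enum !inE.
rewrite cards2 neq_uw; case: (enum _) => [|p [|q [|r l]]] //= sub _.
rewrite inE andbT; have := sub p; have := sub q; rewrite !inE !eqxx orbT /=.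
move=> /(_ isT)/orP[] /eqP-> /(_ isT)/orP[] /eqP->; rewrite ?eqxx // => _.
by rewrite vertex_lengthC.
Qed.

(** Up to swapping the endpoints the length is [w - u] or [v - (w - u)], and [d] divides [v]. *)
Lemma vertex_length_mod {v} d (u w : 'I_v) :
  d %| v -> d %| vertex_length u w -> u = w %[mod d].
Proof.
wlog le_uw : u w / u <= w => [hw dv duw|dv].
  have [/hw->//|/ltnW/hw<-//] := leqP u w.
  by rewrite vertex_lengthC.
rewrite vertex_length_le // => dl; apply/eqP; rewrite eq_sym eqn_mod_dvd //.
move: dl; rewrite /minn; case: ifP => // _.
have le_v : w - u <= v by have := ltn_ord w; lia.
by rewrite dvdn_subr.
Qed.

Lemma odd_vertex_length {v} (u w : 'I_v) :
  ~~ odd v -> odd (vertex_length u w) = odd (u + w).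
Proof.
wlog le_uw : u w / u <= w => [hw ev|ev].
  have [/hw->//|/ltnW/hw] := leqP u w.
  by rewrite vertex_lengthC addnC => ->.
rewrite vertex_length_le //; have := ltn_ord w; lia.
Qed.

(** As [z.*2 <= v], the minimum picks [z] rather than [v - z]. *)
Lemma vertex_length_shift {v} (A z : nat) (u w : 'I_v) :
  z.*2 <= v -> u = A %% v :> nat -> w = (A + z) %% v :> nat ->
  vertex_length u w = z.
Proof.
move=> z_le eu; rewrite -modnDml -eu.
have := ltn_ord u; have := ltn_ord w; move=> ltw ltu.
have [lt|ge] := ltnP (u + z) v.
  by rewrite modn_small // => ew; rewrite vertex_length_le; lia.
(* The shift wraps around: now [w] lies below [u], at distance [v - z]. *)
have -> : u + z = (u + z - v) + v by lia.
rewrite modnDr modn_small; last by lia.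
by move=> ew; rewrite vertex_lengthC vertex_length_le; lia.
Qed.

(** * Length lists and matchings from involutions *)

Lemma count_length_list {v} (p : pred nat) (F : {set {set 'I_v}}) :
  count p (length_list F) = #|[set e in F | p (edge_length e)]|.
Proof.
rewrite /length_list count_map -size_filter cardE.
rewrite /enum_mem -filter_predI; congr size; apply: eq_filter => e /=.
by rewrite !inE andbC.
Qed.

Lemma perm_eq_two_values (T : eqType) (x y : T) a b (s : seq T) :
  {subset s <= [:: x; y]} -> count_mem x s = b -> size s = b + a ->
  perm_eq s (nseq b x ++ nseq a y).
Proof.
move=> sxy cx sz; rewrite perm_sym -(permPr (permEl (perm_filterC (pred1 x) s))).
have -> : [seq z <- s | pred1 x z] = nseq b x.
  by rewrite -cx -size_filter; apply/all_pred1P; exact: filter_all.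
suff -> : [seq z <- s | predC (pred1 x) z] = nseq a y by [].
have <- : size [seq z <- s | predC (pred1 x) z] = a.
  by apply/eqP; rewrite size_filter -(eqn_add2l b) -sz -cx -(count_predC (pred1 x)).
apply/all_pred1P/allP => z; rewrite mem_filter /= => /andP[zx /sxy].
by rewrite !inE (negPf zx).
Qed.

(** The blocks are the orbits of [f]: two orbits sharing a point coincide, and a fixed point gives a
    singleton. *)
Lemma partition_involution (T : finType) (f : T -> T) (P : {set T}) :
  involutive f -> (forall u, (f u \in P) = (u \in P)) ->
  partition [set [set u; f u] | u in P] P.
Proof.
move=> fK fP; apply/and3P; split.
- rewrite /cover; apply/eqP/setP=> u; apply/bigcupP/idP => [[e]|uP].
    by case/imsetP=> w wP ->; rewrite !inE => /orP[] /eqP->; rewrite ?fP.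
  by exists [set u; f u]; [exact: imset_f | exact: set21].
- apply/trivIsetP=> _ _ /imsetP[u uP ->] /imsetP[w wP ->].
  apply: contraR => /pred0Pn[z]; rewrite !inE /=.
  case/andP=> /orP[] /eqP-> /orP[] /eqP.
  + by move->.
  + by move->; rewrite fK setUC.
  + by move<-; rewrite fK setUC.
  + by move/(can_inj fK)->.
- by apply/imsetP=> -[u _ /setP/(_ u)]; rewrite !inE eqxx.
Qed.

Lemma card_involution_pairs (T : finType) (f : T -> T) (P : {set T}) :
  involutive f -> (forall u, f u != u) -> (forall u, (f u \in P) = (u \in P)) ->
  #|P| = #|[set [set u; f u] | u in P]| * 2.
Proof.
move=> fK fx fP; apply: card_uniform_partition (partition_involution _ _ _ fK fP).
by move=> _ /imsetP[u _ ->]; rewrite cards2 eq_sym fx.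
Qed.

(** The edges are the orbits of [f]; [P] collects the endpoints of those of length [x], whence its
    [b * 2] points. *)
Lemma matching_of_involution n b x y (f : 'I_(2 * n) -> 'I_(2 * n))
    (P : {set 'I_(2 * n)}) :
  involutive f -> (forall u, f u != u) -> (forall u, (f u \in P) = (u \in P)) ->
  x <> y -> #|P| = b * 2 ->
  (forall u, vertex_length u (f u) = if u \in P then x else y) ->
  exists F : {set {set 'I_(2 * n)}},
    perfect_matching F /\
    perm_eq (length_list F) (nseq b x ++ nseq (n - b) y).
Proof.
move=> fK fx fP neq_xy cardP lenf.
have len2 u : edge_length [set u; f u] = if u \in P then x else y.
  by rewrite edge_length2 // eq_sym.
have fT (u : 'I_(2 * n)) : (f u \in setT) = (u \in setT) by rewrite !inE.
pose F : {set {set 'I_(2 * n)}} := [set [set u; f u] | u in setT]; exists F.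
have cardF : #|F| = n.
  apply/eqP; rewrite -(eqn_pmul2r (isT : 0 < 2)).
  by rewrite -(card_involution_pairs _ _ _ fK fx fT) cardsT card_ord mulnC.
have /and3P[/eqP covF trivF _] := partition_involution _ _ _ fK fT.
have b_le : b <= n.
  by have := max_card P; rewrite card_ord cardP; lia.
split.
  split=> //; apply/subsetP=> _ /imsetP[u _ ->].
  by rewrite inE cards2 [u == _]eq_sym fx.
apply: perm_eq_two_values.
- move=> _ /mapP[e + ->]; rewrite mem_enum => /imsetP[u _ ->].
  by rewrite len2 !inE; case: ifP; rewrite eqxx ?orbT.
- rewrite count_length_list.
  have -> : [set e in F | pred1 x (edge_length e)] = [set [set u; f u] | u in P].
    apply/setP=> e; rewrite inE; apply/andP/imsetP => [[/imsetP[u _ ->]]|[u uP ->]].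
      rewrite /= len2; case: ifP => [uP _|_ /eqP]; first by exists u.
      by move=> eq_yx; case: neq_xy.
    by split; [exact: imset_f | rewrite /= len2 uP].
  apply/eqP; rewrite -(eqn_pmul2r (isT : 0 < 2)).
  by rewrite -(card_involution_pairs _ _ _ fK fx fP) cardP.
- by rewrite size_map -cardE cardF; lia.
Qed.

(** Transport along [phi] lets the involution be defined on grid coordinates. *)
Lemma matching_of_coordinates n b x y (T : finType) (phi : T -> 'I_(2 * n))
    (f : T -> T) (P : {set T}) :
  bijective phi -> involutive f -> (forall t, f t != t) ->
  (forall t, (f t \in P) = (t \in P)) -> x <> y -> #|P| = b * 2 ->
  (forall t, vertex_length (phi t) (phi (f t)) = if t \in P then x else y) ->
  exists F : {set {set 'I_(2 * n)}},
    perfect_matching F /\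
    perm_eq (length_list F) (nseq b x ++ nseq (n - b) y).
Proof.
move=> [psi phiK psiK] fK fx fP neq_xy cardP lenf.
have psiP u : (u \in phi @: P) = (psi u \in P).
  by rewrite -{1}(psiK u) mem_imset //; exact: can_inj phiK.
apply: (@matching_of_involution n b x y (phi \o f \o psi) (phi @: P)) => //.
- by move=> u /=; rewrite phiK fK psiK.
- by move=> u /=; rewrite -(can_eq psiK) phiK fx.
- by move=> u /=; rewrite !psiP phiK fP.
- by rewrite card_imset //; exact: can_inj phiK.
- by move=> u /=; rewrite psiP -{1}(psiK u) lenf.
Qed.

Lemma exists_set_card (T : finType) k :
  k <= #|T| -> exists S : {set T}, #|S| = k.
Proof.
move=> k_le; exists [set t in take k (enum T)].
rewrite cardsE (card_uniqP _) ?take_uniq ?enum_uniq //.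
by rewrite size_takel // -cardE.
Qed.

(** * Linear coordinates modulo 2n *)

Lemma eqn_modMr d y i j :
  coprime d y -> (i * y == j * y %[mod d]) = (i == j %[mod d]).
Proof.
move=> co_dy; wlog le_ji : i j / j <= i => [hw|].
  by have [/hw//|/ltnW/hw] := leqP j i; rewrite eq_sym [RHS]eq_sym.
by rewrite !eqn_mod_dvd ?leq_mul2r ?le_ji ?orbT // -mulnBl Gauss_dvdl.
Qed.

(** Modulo [d] the multiples of [x] vanish and [y] cancels, so [i = i']. Dividing what remains by
    [d] leaves a congruence modulo [m], where [x / d] is invertible. *)
Lemma linear_mod_inj d m x y i j i' j' :
  0 < d -> d %| x -> d = gcdn x (d * m) -> coprime d y ->
  i < d -> i' < d -> j < m -> j' < m ->
  i * y + j * x = i' * y + j' * x %[mod d * m] -> i = i' /\ j = j'.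
Proof.
move=> d_gt0 dvd_x dE co_dy lti lti' ltj ltj' E.
have eqi : i = i'.
  have /(congr1 (modn^~ d)) := E.
  rewrite !modn_dvdm ?dvdn_mulr // -![(_ + _ * x) %% d]modnDmr.
  have dj k : (k * x) %% d = 0 by apply/eqP; rewrite -/(_ %| _) dvdn_mull.
  rewrite !dj !addn0 => /eqP.
  by rewrite eqn_modMr // !modn_small // => /eqP.
split=> //; move/eqP: E; rewrite -eqi eqn_modDl.
case/dvdnP: dvd_x => z xz; have co_mz : coprime m z.
  move: dE; rewrite xz [z * d]mulnC -muln_gcdr => /eqP.
  by rewrite -{1}[d]muln1 eqn_pmul2l // eq_sym gcdnC.
have jE k : k * x = d * (k * z) by rewrite xz mulnA mulnC.
rewrite !jE -!muln_modr eqn_pmul2l // eqn_modMr // !modn_small //.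
by move/eqP.
Qed.

(** * Necessity: parity and residue classes *)

Lemma odd_sum (I : finType) (P : pred I) (g : I -> nat) :
  odd (\sum_(i | P i) g i) = \big[addb/false]_(i | P i) odd (g i).
Proof. by apply: (big_morph odd oddD). Qed.

Lemma sum_matching n (F : {set {set 'I_(2 * n)}}) (g : 'I_(2 * n) -> nat) :
  perfect_matching F -> \sum_u g u = \sum_(e in F) \sum_(u in e) g u.
Proof.
case=> _ _ trivF covF; rewrite -(big_trivIset _ trivF) covF.
by apply: eq_bigl => u; rewrite inE.
Qed.

Lemma matching_edgeP n (F : {set {set 'I_(2 * n)}}) e :
  perfect_matching F -> e \in F ->
  exists u w, u != w /\ e = [set u; w].
Proof.
by case=> /subsetP subF _ _ _ /subF; rewrite inE => /cards2P[u [w [? ->]]]; exists u, w.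
Qed.

Lemma sum_pair (T : finType) (u w : T) (g : T -> nat) :
  u != w -> \sum_(z in [set u; w]) g z = g u + g w.
Proof. by move=> neq_uw; rewrite big_setU1 ?inE //= big_set1. Qed.

(** A length has the parity of the sum of the two endpoints, and every vertex lies on exactly one
    edge. *)
Lemma odd_sum_length n (F : {set {set 'I_(2 * n)}}) :
  perfect_matching F -> odd (sumn (length_list F)) = odd n.
Proof.
move=> pmF.
have -> : sumn (length_list F) = \sum_(e in F) edge_length e.
  by rewrite sumnE /length_list big_map big_enum.
transitivity (odd (\sum_(u < 2 * n) u)).
  rewrite (sum_matching _ _ _ pmF) !odd_sum.
  apply: eq_bigr => e eF; have [u [w [neq_uw ->]]] := matching_edgeP _ _ _ pmF eF.
  by rewrite sum_pair // edge_length2 // odd_vertex_length // mul2n odd_double.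
(* Passing from [n] to [n + 1] adds the vertices [2n] and [2n + 1], whose sum is odd. *)
elim: n {F pmF} => [|n IHn]; first by rewrite big_ord0.
by rewrite mulnS !big_ord_recr /= !oddD IHn mul2n /= odd_double /=; case: odd.
Qed.

Lemma card_residue_class d m r : r < d -> \sum_(u < m * d) (u %% d == r) = m.
Proof.
move=> ltr; elim: m => [|m IHm]; first by rewrite big_ord0.
rewrite mulSn big_split_ord /=.
under [X in _ + X]eq_bigr do rewrite modnDl.
rewrite IHm (bigD1 (Ordinal ltr)) //= modn_small // eqxx big1 // => i neq_i.
rewrite modn_small //; apply/eqP; rewrite eqb0.
by apply: contra neq_i => /eqP eq_ir; apply/eqP/val_inj.
Qed.

(* An odd class mod [d] cannot be exhausted by edges joining congruent vertices,
   so each of the [d] classes contains an endpoint of a remaining edge. *)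
Lemma odd_classes_bound n d m (F : {set {set 'I_(2 * n)}}) :
  perfect_matching F -> 2 * n = m * d -> odd m -> 0 < d ->
  d <= 2 * count (fun l => ~~ (d %| l)) (length_list F).
Proof.
move=> pmF nE odd_m d_gt0; rewrite count_length_list.
set FY := [set e in F | _].
have <- : \sum_(e in FY) #|e| = 2 * #|FY|.
  rewrite (mulnC 2 #|FY|) -sum_nat_const; apply: eq_bigr => e; rewrite inE => /andP[eF _].
  by have [u [w [neq_uw ->]]] := matching_edgeP _ _ _ pmF eF; rewrite cards2 neq_uw.
apply: leq_trans (leq_card_cover FY).
pose cl (u : 'I_(2 * n)) := Ordinal (ltn_pmod u d_gt0).
suff -> : d = #|cl @: cover FY| by exact: leq_imset_card.
suff -> : cl @: cover FY = setT by rewrite cardsT card_ord.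
apply/setP=> r; rewrite inE.
have: odd (\sum_(u < 2 * n) (u %% d == r)) by rewrite nE card_residue_class.
rewrite (sum_matching _ _ (fun u => nat_of_bool (u %% d == r)) pmF) odd_sum.
(* If [r] is missed, an edge of length divisible by [d] has both or no endpoints in class [r], and
   any other edge lies in [FY] and has none: the class would be even. *)
apply: contraLR => notin; rewrite big1 // => e eF.
have [dvd_e|ndvd_e] := boolP (d %| edge_length e).
  have [u [w [neq_uw eE]]] := matching_edgeP _ _ _ pmF eF.
  rewrite eE sum_pair //; move: dvd_e; rewrite eE edge_length2 //.
  have dvd_v : d %| 2 * n by rewrite nE dvdn_mull.
  by move/(vertex_length_mod _ _ _ dvd_v) => /= ->; rewrite addnn odd_double.
rewrite big1 // => u ue; apply/eqP; rewrite eqb0.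
apply: contra notin => /eqP ur; apply/imsetP; exists u; last exact/val_inj.
by apply/bigcupP; exists e; rewrite // inE eF.
Qed.

(** As [d] is even, [x] is even and [y] odd, so the lengths sum to the parity of [a]. Only the [a]
    copies of [y] can fail to be divisible by [d]. *)
Lemma matching_necessary n d m x y a (F : {set {set 'I_(2 * n)}}) :
  perfect_matching F -> a <= n -> 2 * n = m * d -> 0 < d -> ~~ odd d ->
  d %| x -> coprime d y ->
  perm_eq (length_list F) (nseq (n - a) x ++ nseq a y) ->
  ~~ odd (n - a) /\ (odd m -> d <= 2 * a).
Proof.
move=> pmF le_an nE d_gt0 even_d dvd_x co_dy lenF.
have even_x : ~~ odd x.
  by move: even_d; rewrite -!dvdn2 => /dvdn_trans; apply.
have odd_y : odd y.
  rewrite -dvdn2 in even_d; have := coprime_dvdl even_d co_dy.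
  by rewrite coprime2n.
split=> [|odd_m].
  have := odd_sum_length _ _ pmF.
  rewrite (perm_sumn lenF) sumn_cat !sumn_nseq oddD !oddM (negPf even_x) odd_y /=.
  by rewrite oddB // => <-; rewrite addbb.
apply: leq_trans (odd_classes_bound _ _ _ _ pmF nE odd_m d_gt0) _.
rewrite leq_mul2l /= (permP lenF) count_cat !count_nseq dvd_x /= mul0n add0n.
by case: (_ %| _); rewrite ?mul0n ?mul1n.
Qed.

(** * Sufficiency: matching the grid *)

(* The vertex [i * y + j * x], with [i < d] and [j < m], has row [i = 2p + b] and
   column [j]; a column is [2q + c], or the last one when [m] is odd.  Each block
   of rows [2p, 2p+1] and columns [2q, 2q+1] can be matched by two edges of
   length [x] or by two edges of length [y]. *)
Lemma matching_sufficient n d' m x y k :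
  0 < d' -> 2 * n = d'.*2 * m -> d'.*2 = gcdn x (2 * n) -> coprime d'.*2 y ->
  x <= n -> y <= n -> x <> y -> k <= d' * m./2 ->
  exists F : {set {set 'I_(2 * n)}},
    perfect_matching F /\
    perm_eq (length_list F) (nseq k.*2 x ++ nseq (n - k.*2) y).
Proof.
move=> d'_gt0 nE dE co_dy x_le y_le neq_xy k_le.
(* [S] selects the blocks matched by two edges of length [x]. *)
have [S cardS] : exists S : {set 'I_d' * 'I_m./2}, #|S| = k.
  by apply: exists_set_card; rewrite card_prod !card_ord.
(* ['I_(odd m)] is a single point for odd [m] and empty otherwise: it encodes the unpaired last
   column. *)
pose T : finType := ('I_d' * bool * ('I_m./2 * bool + 'I_(odd m)))%type.
pose row (t : T) : nat := t.1.1.*2 + t.1.2.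
pose col (t : T) : nat :=
  match t.2 with inl qc => qc.1.*2 + qc.2 | inr o => m./2.*2 end.
pose f (t : T) : T :=
  match t with
  | (p, b, inl (q, c)) =>
    if (p, q) \in S then (p, b, inl (q, ~~ c)) else (p, ~~ b, inl (q, c))
  | (p, b, inr o) => (p, ~~ b, inr o)
  end.
pose P : {set T} :=
  [set t | if t.2 is inl qc then (t.1.1, qc.1) \in S else false].
(* For [n = 0] both [x] and [y] would be 0. *)
have n_gt0 : 0 < 2 * n.
  have := leq0n x; have := leq0n y; move: neq_xy x_le y_le; lia.
pose phi (t : T) : 'I_(2 * n) := Ordinal (ltn_pmod (row t * y + col t * x) n_gt0).
have mE : m = odd m + m./2.*2 by rewrite odd_double_half.
have row_lt t : row t < d'.*2.
  by case: t => [[[p ltp] b] s] /=; rewrite /row /=; case: b; lia.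
have col_lt t : col t < m.
  case: t => [pb [[[q ltq] c]|[o lto]]]; rewrite /col /=; last by lia.
  by case: c; lia.
have rowcol_inj t t' : row t = row t' -> col t = col t' -> t = t'.
  case: t t' => [[p b] s] [[p' b'] s']; rewrite /row /col /= => E1 E2.
  have [Ep Eb] : p = p' :> nat /\ b = b' by case: b b' E1 => [] []; lia.
  rewrite (val_inj Ep) Eb; congr (_, _).
  case: s s' E2 => [[q c]|[o lto]] [[q' c']|[o' lto']] /= E2.
  - have [Eq Ec] : q = q' :> nat /\ c = c' by case: c c' E2 => [] []; lia.
    by rewrite (val_inj Eq) Ec.
  - by have := ltn_ord q; case: c E2 => /=; lia.
  - by have := ltn_ord q'; case: c' E2 => /=; lia.
  - by congr inr; apply: val_inj => /=; lia.
have phi_inj : injective phi.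
  move=> t t' /(congr1 val) /=; rewrite nE => E.
  have [||||||||E1 E2] := linear_mod_inj _ _ _ _ _ _ _ _ _ _ _ _ _ _ _ _ E;
    rewrite ?row_lt ?col_lt ?double_gt0 //.
  - by rewrite dE dvdn_gcdl.
  - by rewrite -nE.
  - exact: rowcol_inj.
have phi_bij : bijective phi.
  apply: inj_card_bij => //.
  rewrite card_ord !card_prod card_sum card_prod !card_ord card_bool nE.
  by rewrite {1}mE; lia.
have fK : involutive f.
  move=> [[p b] [[q c]|o]] /=; rewrite ?negbK //.
  by case: ifP => S_pq /=; rewrite S_pq negbK.
have fx t : f t != t.
  case: t => [[p b] [[q c]|o]] /=; [case: ifP => _|]; apply/eqP => -[];
    [by case: c | by case: b | by case: b].
have fP t : (f t \in P) = (t \in P).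
  by case: t => [[p b] [[q c]|o]] /=; rewrite !inE //=; case: ifP.
apply: (matching_of_coordinates _ _ _ _ _ phi f P) => //.
(* A point of [P] is a block of [S] with two free bits, which gives [4k] points. *)
- pose g (w : 'I_d' * 'I_m./2 * (bool * bool)) : T :=
    (w.1.1, w.2.1, inl (w.1.2, w.2.2)).
  have -> : P = g @: setX S setT.
    apply/setP=> -[[p b] [[q c]|o]]; rewrite inE /=; last first.
      by apply/esym/imsetP => -[[[? ?] [? ?]] _].
    apply/idP/imsetP => [pqS|[[[p' q'] [b' c']]]].
      by exists ((p, q), (b, c)); rewrite ?inE /= ?pqS.
    by rewrite !inE andbT /= => ? [-> _ -> _].
  rewrite card_imset; last by move=> [[? ?] [? ?]] [[? ?] [? ?]] [-> -> -> ->].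
  by rewrite cardsX cardS cardsT card_prod card_bool; lia.
- have shift t t' z : z.*2 <= 2 * n ->
      row t' * y + col t' * x = row t * y + col t * x + z ->
      vertex_length (phi t) (phi t') = z.
    move=> z_le E; apply: (@vertex_length_shift _ (row t * y + col t * x)) => //.
    by rewrite -E.
  have lenx p b q : vertex_length (phi (p, b, inl (q, false)))
                                  (phi (p, b, inl (q, true))) = x.
    by apply: shift; rewrite /row /col /=; nia.
  have leny p s : vertex_length (phi (p, false, s)) (phi (p, true, s)) = y.
    by apply: shift; rewrite /row /col /=; nia.
  case=> [[p b] [[q c]|o]]; rewrite inE /=; [case: ifP => _|].
  + by case: c; rewrite /= ?lenx // vertex_lengthC lenx.
  + by case: b; rewrite /= ?leny // vertex_lengthC leny.
  + by case: b; rewrite /= ?leny // vertex_lengthC leny.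
Qed.

Theorem theorem3p1 (n a x y d : nat)
    (x_even : ~~ odd x) (x_neq_y : x <> y)
    (x_range : 1 <= x <= n) (y_range : 1 <= y <= n) (a_range : 1 <= a < n)
    (d_def : d = gcdn x (2 * n)) (gcd_dy : gcdn d y = 1) :
  (exists F : {set {set 'I_(2 * n)}},
      perfect_matching F /\
      perm_eq (length_list F) (nseq (n - a) x ++ nseq a y))
  <->
  ((d %| n) /\ ~~ odd (n - a)
   \/ ~~ (d %| n) /\ ~~ odd (n - a) /\ n - a <= (2 * n - d) %/ 2).
Proof.
have d_gt0 : 0 < d by rewrite d_def gcdn_gt0; lia.
have even_d : ~~ odd d.
  by rewrite -dvdn2 d_def dvdn_gcd dvdn2 x_even dvdn_mulr.
have dvd_x : d %| x by rewrite d_def dvdn_gcdl.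
have co_dy : coprime d y by apply/eqP.
have dvd_n : d %| 2 * n by rewrite d_def dvdn_gcdr.
case/dvdnP: (dvd_n) => m nE.
have dE : d = d./2.*2 by rewrite even_halfK.
(* From [2 * n = m * d], [d] divides [n] exactly when 2 divides [m]. *)
have dvd_nE : (d %| n) = ~~ odd m.
  rewrite -(@dvdn_pmul2l 2) // nE -dvdn2 [m * d]mulnC [2 * d]mulnC.
  by rewrite dvdn_pmul2l.
rewrite dvd_nE negbK; split=> [[F [pmF lenF]]|cond].
  have le_an : a <= n by lia.
  have [even_na bound] :=
    matching_necessary _ _ _ _ _ _ _ pmF le_an nE d_gt0 even_d dvd_x co_dy lenF.
  (* [d] being even, [d <= 2 * a] rearranges to the bound of case (2). *)
  by case: (boolP (odd m)) => odd_m; [right | left]; split=> //; split=> //;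
    have := bound odd_m; lia.
have even_na : ~~ odd (n - a) by case: cond => [[]|[? []]].
have naE : n - a = (n - a)./2.*2 by rewrite even_halfK.
(* Here [n = d./2 * m]. The number of blocks is [n / 2] for even [m], and [(n - d / 2) / 2] for odd
   [m], where case (2) is exactly what is needed. *)
have k_le : (n - a)./2 <= d./2 * m./2.
  have mE := odd_double_half m.
  have E : n = d./2 * m by apply/eqP; rewrite -(eqn_pmul2l (isT : 0 < 2)) nE {1}dE; lia.
  have [odd_m|even_m] := boolP (odd m).
    case: cond => [[]|[_ [_ le]]]; first by rewrite odd_m.
    by rewrite odd_m in mE; rewrite -mE in E; nia.
  by rewrite (negPf even_m) in mE; rewrite -mE in E; nia.
have [||||||||F [pmF lenF]] := matching_sufficient n d./2 m x y (n - a)./2 => //;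
  rewrite -?dE //; try lia.
by exists F; split=> //; move: lenF; rewrite -naE subKn //; lia.
Qed.
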